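(* Let $A\in\mathbb{Z}$ with $A\equiv 1\pmod 4$, and for an integer $n\ge 3$ let \[\mathcal{F}_{n,A,A}(x)=x^{2^n}+Ax^{3\cdot 2^{n-2}}+Ax^{2^{n-1}}+Ax^{2^{n-2}}+1.\] Then $\mathcal{F}_{n,A,A}(x)$ is irreducible over $\mathbb{Q}$ if and only if $A\neq 1$. *)

(* Defs.v *)
From HB Require Import structures.
From mathcomp Require Import all_boot all_order all_algebra.
Set Implicit Arguments. Unset Strict Implicit. Unset Printing Implicit Defensive.
Import Order.TTheory GRing.Theory Num.Theory.
Local Open Scope ring_scope.

(* The polynomial F_{n,A,A}; [n - 2] and [n - 1] are truncated subtractions, so
   this is the intended polynomial only for [2 <= n]. *)
Definition calF (n : nat) (A : int) : {poly int} :=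
  'X^(2 ^ n)%N + A *: 'X^(3 * 2 ^ (n - 2))%N + A *: 'X^(2 ^ (n - 1))%N
  + A *: 'X^(2 ^ (n - 2))%N + 1.

Definition irreducible_over_rat (p : {poly int}) : Prop :=
  irreducible_poly (map_poly (intr : int -> rat) p).

(* Main.v *)
(* Write [F_n(x) = f(x^(2^m))] with [m = n - 2] and [f = y^4 + A y^3 + A y^2 + A y + 1],
   which is irreducible by a parity argument on the coefficients of a factorization.
   If [P(x)] is irreducible and [P(x^2)] is not, then [x] is a square modulo [P]. When
   [P(x) = Q(x^2)], taking the norm of a square root of [x] from [K[x]/(Q(x^2))] to
   [K[x^2]/(Q(x^2))] makes [-x] a square modulo [Q], and the same works from a square
   root of [-x]. Descending to [f], irreducibility of [f(x^2)] and of [f(-x^2)] implies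
   that of all [f(x^(2^m))]. By Gauss's lemma a proper factorization of [f(s x^2)],
   [s = 1] or [-1], would have the shape [p(x) p(-x)] with [p] an integral quartic;
   comparing coefficients and reducing modulo 8 leaves only [s = 1, A = 1], where
   [f(x^2) = Phi_5(x) Phi_10(x)]. *)
Require Import Defs.
From HB Require Import structures.
From mathcomp Require Import all_boot all_order all_algebra.
From mathcomp Require Import ring zify.
Set Implicit Arguments. Unset Strict Implicit. Unset Printing Implicit Defensive.
Import Order.TTheory GRing.Theory Num.Theory.
Local Open Scope ring_scope.

(* [size] occurs here under several convertible ring instances, which [lia] would
   treat as distinct atoms. *)
Ltac size_lia :=
  repeat match goal with |- context [@size _ (@polyseq _ ?p)] =>
    move: (size p) => ? end; lia.

(** * Substitution of x^2 and the Graeffe transform *)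

Lemma size_comp_X2 (R : idomainType) (p : {poly R}) :
  (size (p \Po 'X^2)).-1 = ((size p).-1 * 2)%N.
Proof. by rewrite size_comp_poly size_polyXn. Qed.

Lemma comp_X2_eq0 (R : idomainType) (p : {poly R}) :
  (p \Po 'X^2 == 0) = (p == 0).
Proof. by rewrite comp_poly_eq0 // size_polyXn. Qed.

Lemma comp_X2_NX (R : comNzRingType) (p : {poly R}) :
  (p \Po 'X^2) \Po (- 'X) = p \Po 'X^2.
Proof. by rewrite -comp_polyA comp_Xn_poly sqrrN. Qed.

(** A nonzero remainder r of q modulo p gives r(x^2) of degree still below that of p(x^2), so p(x^2)
    cannot divide it. *)
Lemma dvdp_comp_X2 (F : fieldType) (p q : {poly F}) :
  (p \Po 'X^2 %| q \Po 'X^2) = (p %| q).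
Proof.
apply/idP/idP => [|/dvdp_comp_poly->//].
have [->|p0] := eqVneq p 0; first by rewrite comp_poly0 !dvd0p comp_X2_eq0.
rewrite {1}(divp_eq q p) comp_polyD comp_polyM dvdp_addr ?dvdp_mull //.
rewrite [p %| q]/dvdp; apply: contraTT => r0; apply/negP => /dvdp_leq.
rewrite comp_X2_eq0 => /(_ r0); have := ltn_modpN0 q p0.
have := size_comp_X2 p; have := size_comp_X2 (q %% p).
have : (q %% p) \Po 'X^2 != 0 by rewrite comp_X2_eq0.
move: p0 r0; rewrite -!size_poly_gt0; size_lia.
Qed.

(* The Graeffe transform: the polynomial [G] with [G(x^2) = p(x) p(-x)]. *)
Definition graeffe (R : comNzRingType) (p : {poly R}) : {poly R} :=
  even_poly p ^+ 2 - odd_poly p ^+ 2 * 'X.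

Lemma graeffe_comp_X2 (R : comNzRingType) (p : {poly R}) :
  graeffe p \Po 'X^2 = p * (p \Po (- 'X)).
Proof.
rewrite -{2 3}(poly_even_odd p) /graeffe.
rewrite comp_polyB comp_polyD !comp_polyM !comp_X2_NX !comp_polyX; ring.
Qed.

(** Substituting x^2 doubles the degree, and so does multiplying p(x) by p(-x). *)
Lemma size_graeffe (R : idomainType) (p : {poly R}) : size (graeffe p) = size p.
Proof.
have [->|p0] := eqVneq p 0.
  by rewrite /graeffe even_polyC odd_polyC expr0n mul0r subr0.
have sNX : size (- 'X : {poly R}) = 2 by rewrite size_polyN size_polyX.
have pN0 : p \Po (- 'X) != 0 by rewrite comp_poly2_eq0.
have g0 : graeffe p != 0.
  by rewrite -comp_X2_eq0 graeffe_comp_X2 mulf_neq0.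
have := size_comp_X2 (graeffe p).
rewrite graeffe_comp_X2 size_mul // size_comp_poly2 //.
move: p0 g0; rewrite -!size_poly_gt0; size_lia.
Qed.

Lemma map_graeffe (R S : comNzRingType) (f : {rmorphism R -> S}) (p : {poly R}) :
  map_poly f (graeffe p) = graeffe (map_poly f p).
Proof.
have even : map_poly f (even_poly p) = even_poly (map_poly f p).
  by apply/polyP => i; rewrite !(coef_map, coef_even_poly).
have odd : map_poly f (odd_poly p) = odd_poly (map_poly f p).
  by apply/polyP => i; rewrite !(coef_map, coef_odd_poly).
by rewrite /graeffe !expr2 rmorphB !rmorphM /= map_polyX even odd.
Qed.

(** * Square roots of x modulo an irreducible polynomial *)

Section SquareRootOfX.
Variable F : fieldType.
Implicit Types p q t u : {poly F}.

Lemma irreducible_dvdp_or_coprimep p q :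
  irreducible_poly p -> p %| q \/ coprimep p q.
Proof.
move=> irr; have [e|e] := irredp_XsubCP irr (dvdp_gcdl p q).
  by right; rewrite -gcdp_eqp1.
by left; rewrite -(eqp_dvdl _ e) dvdp_gcdr.
Qed.

(** Both q(x) and q(-x) divide p(x^2), so [graeffe q] divides p^2. Being no unit, it is associated
    to p or to p^2; in the latter case q already has the degree of p(x^2). *)
Lemma graeffe_factor p q :
  irreducible_poly p -> q %| p \Po 'X^2 -> size q != 1 ->
  q %= p \Po 'X^2 \/ graeffe q %= p.
Proof.
move=> irr qp q1; have p0 := irredp_neq0 irr.
have gp : graeffe q %| p ^+ 2.
  rewrite -dvdp_comp_X2 graeffe_comp_X2 expr2 comp_polyM.
  by rewrite dvdp_mul // -(comp_X2_NX p) dvdp_comp_poly.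
have [|cop] := irreducible_dvdp_or_coprimep (graeffe q) irr; last first.
  have : coprimep (graeffe q) (p ^+ 2) by rewrite coprimep_sym coprimep_expl.
  by move/coprimepP/(_ _ (dvdpp _) gp); rewrite -size_poly_eq1 size_graeffe (negPf q1).
case/dvdpP => r gE; move: gp; rewrite gE expr2 dvdp_mul2r // => rp.
have [e|e] := irredp_XsubCP irr rp.
  by right; rewrite -{2}(mul1r p) eqp_mul2r.
left; rewrite -dvdp_size_eqp //; apply/eqP.
have r0 : r != 0 by apply: contraNneq p0 => r0; move: e; rewrite r0 eqp_sym eqp0.
have := size_graeffe q; rewrite gE size_mul // (eqp_size e) => <-.
have := size_comp_X2 p.
have : p \Po 'X^2 != 0 by rewrite comp_X2_eq0.
move: p0; rewrite -!size_poly_gt0; size_lia.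
Qed.

Lemma sqrt_X_of_reducible p q :
  irreducible_poly p -> q %| p \Po 'X^2 -> size q != 1 ->
  q %= p \Po 'X^2 \/ exists t, p %| t ^+ 2 - 'X.
Proof.
move=> irr qp q1; have [|e] := graeffe_factor irr qp q1; first by left.
right; have p0 := irredp_neq0 irr; have [p1 irrp] := irr.
have sq : size q = size p by rewrite -size_graeffe (eqp_size e).
have [po|/Bezout_eq1_coprimepP[[v w] /= vw]] := irreducible_dvdp_or_coprimep (odd_poly q) irr.
  (* The odd part has smaller degree than p, so it vanishes; then p would be associated to the
     square of the even part. *)
  have o0 : odd_poly q = 0.
    apply/eqP; apply/idPn => o0; have := dvdp_leq o0 po.
    by move: p1; have := size_odd_poly q; rewrite sq; size_lia.
  move: e; rewrite /graeffe o0 expr0n mul0r subr0 => e.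
  have : even_poly q %| p by rewrite -(eqp_dvdr _ e) expr2 dvdp_mulIl.
  have := eqp_size e; have := size_exp (even_poly q) 2.
  move=> s1 s2 /irrp e1.
  have : size (even_poly q) = 1 \/ size (even_poly q) = size p.
    by case: eqP e1 => [->|_ /(_ isT)/eqp_size->]; [left | right].
  by move: p1 s1 s2; size_lia.
(* Modulo p, [w] inverts the odd part O of q, and [graeffe q] = 0 reads E^2 = x O^2 with E the even
   part, so E/O is a square root of x. *)
exists (even_poly q * w).
have -> : (even_poly q * w) ^+ 2 - 'X =
    w ^+ 2 * graeffe q - 'X * (1 + w * odd_poly q) * (v * p).
  by rewrite (_ : v * p = 1 - w * odd_poly q) /graeffe; [ring | rewrite -vw; ring].
by rewrite dvdp_sub ?dvdp_mull // (eqp_dvdr _ e).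
Qed.

(* Norm of a square root of [x] from [F[x]/(p(x^2))] down to [F[x^2]/(p(x^2))]. *)
Lemma sqrt_X_descent p t (s : F) :
  s ^+ 2 = 1 -> p \Po 'X^2 %| t ^+ 2 - s *: 'X -> exists u, p %| u ^+ 2 + 'X.
Proof.
move=> s1 pt; exists (graeffe t); rewrite -dvdp_comp_X2.
have ptN := dvdp_comp_poly (- 'X) pt.
move: ptN; rewrite comp_X2_NX comp_polyB rmorphXn /= comp_polyZ comp_polyX => ptN.
have s1P : s%:P ^+ 2 = 1 by rewrite -rmorphXn s1.
(* The two summands are multiples of t^2 - s x and of its image under x -> -x, both divisible by
   p(x^2). *)
have -> : (graeffe t ^+ 2 + 'X) \Po 'X^2 = (t \Po (- 'X)) ^+ 2 * (t ^+ 2 - s *: 'X)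
    + s *: 'X * ((t \Po (- 'X)) ^+ 2 - s *: (- 'X)).
  rewrite comp_polyD rmorphXn /= comp_polyX graeffe_comp_X2 -!mul_polyC.
  rewrite -[X in _ + X](mul1r) -s1P; ring.
by rewrite dvdp_add ?dvdp_mull.
Qed.

Lemma comp_X2n p n : p \Po 'X^(2 ^ n.+1) = (p \Po 'X^(2 ^ n)) \Po 'X^2.
Proof. by rewrite -comp_polyA comp_Xn_poly -exprM expnS. Qed.

(** After one descent the sign is s = -1, and descending from a root of -x again gives a root of
    -x. *)
Lemma sqrt_X_descent_iter n p t (s : F) :
  s ^+ 2 = 1 -> p \Po 'X^(2 ^ n.+1) %| t ^+ 2 - s *: 'X ->
  exists u, p %| u ^+ 2 + 'X.
Proof.
elim: n t s => [|n IH] t s s1; first by rewrite expn1; apply: sqrt_X_descent.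
rewrite comp_X2n => /(sqrt_X_descent s1)[u pu].
by apply: (IH u (-1)); rewrite ?sqrrN ?expr1n // scaleN1r opprK.
Qed.

(** Put P = p(s x^2) and T = t(s x^2). Then P divides (T - x)(T + x), hence one factor, hence both
    since P and T are even, hence 2x. But P has positive even degree. *)
Lemma not_sqrt_X p t (s : F) :
  (2%:R != 0 :> F) -> s ^+ 2 = 1 -> irreducible_poly (p \Po (s *: 'X^2)) ->
  ~ p %| t ^+ 2 - s *: 'X.
Proof.
move=> two0 s1 irr pt.
have s0 : s != 0 by apply/eqP => s0; move/eqP: s1; rewrite s0 expr0n eq_sym oner_eq0.
set P := p \Po _ in irr; set T := t \Po (s *: 'X^2).
have ev q : (q \Po (s *: 'X^2)) \Po (- 'X) = q \Po (s *: 'X^2).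
  by rewrite -comp_polyA comp_polyZ comp_Xn_poly sqrrN.
have PT : P %| (T - 'X) * (T + 'X).
  have := dvdp_comp_poly (s *: 'X^2) pt.
  rewrite comp_polyB rmorphXn /= comp_polyZ comp_polyX scalerA -expr2 s1 scale1r.
  by rewrite -subr_sqr.
have PNT : P %| T - 'X <-> P %| T + 'X.
  split=> /(dvdp_comp_poly (- 'X)); rewrite ?comp_polyB ?comp_polyD !ev comp_polyX //.
  by rewrite opprK.
have P2X : P %| 2%:R *: 'X.
  have [a b] : P %| T - 'X /\ P %| T + 'X.
    have [a|cop] := irreducible_dvdp_or_coprimep (T - 'X) irr; first tauto.
    by move: PT; rewrite Gauss_dvdpr //; tauto.
  have -> : 2%:R *: 'X = (T + 'X) - (T - 'X) by rewrite scaler_nat; ring.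
  exact: dvdp_sub.
have := dvdp_leq _ P2X; rewrite scaler_eq0 (negPf two0) polyX_eq0 => /(_ isT).
rewrite size_scale // size_polyX.
have [P1 _] := irr; have := size_comp_poly p (s *: 'X^2).
rewrite size_scale // size_polyXn -/P; lia.
Qed.

Theorem irreducible_comp_X2n p n :
  (2%:R != 0 :> F) -> irreducible_poly p ->
  irreducible_poly (p \Po 'X^2) -> irreducible_poly (p \Po - 'X^2) ->
  irreducible_poly (p \Po 'X^(2 ^ n)).
Proof.
move=> two0 irr irr2 irrN2; elim: n => [|n IH]; first by rewrite comp_polyXr.
rewrite comp_X2n; split.
  by have [+ _] := IH; have := size_comp_X2 (p \Po 'X^(2 ^ n)); size_lia.
move=> q q1 qp; have [//|[t pt]] := sqrt_X_of_reducible IH qp q1; exfalso.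
(* With no level to descend, x itself is a square modulo p, against [irr2]; otherwise descent makes
   -x a square, against [irrN2]. *)
case: n pt {IH qp} => [|n] pt.
  rewrite comp_polyXr -[X in _ - X]scale1r in pt.
  by apply: not_sqrt_X pt; rewrite ?scale1r ?expr1n.
rewrite -[X in _ - X]scale1r in pt.
have [|u pu] := sqrt_X_descent_iter _ pt; first by rewrite expr1n.
have {}pu : p %| u ^+ 2 - (- 1) *: 'X by rewrite scaleN1r opprK.
by apply: not_sqrt_X pu; rewrite ?scaleN1r ?sqrrN ?expr1n.
Qed.

End SquareRootOfX.

(** * Integer arithmetic and parity *)

Lemma int_unit_mul (a b : int) : a * b = 1 -> (a = 1 /\ b = 1) \/ (a = - 1 /\ b = - 1).
Proof.
move=> ab; have : (`|a| * `|b| == 1)%N by rewrite -abszM ab.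
by rewrite muln_eq1 => /andP[/eqP a1 /eqP b1]; move: ab; lia.
Qed.

Lemma odd_add_even (a b : int) :
  (a + b = 1 %[mod 2])%Z -> exists k, a = 2 * k \/ b = 2 * k.
Proof.
move=> ab; have [a0|a1] : (a %% 2)%Z = 0 \/ (a %% 2)%Z = 1 by lia.
  by exists (a %/ 2)%Z; lia.
by exists (b %/ 2)%Z; lia.
Qed.

Lemma sqr_add1 (x y : int) : x * x + 1 = y * y -> x = 0.
Proof.
wlog [x0 y0] : x y / 0 <= x /\ 0 <= y => [H e|e].
  by have := H `|x| `|y|; lia.
have : x < y by nia.
nia.
Qed.

Lemma even_or_odd (x : int) : exists q, x = 2 * q \/ x = 2 * q + 1.
Proof. by exists (x %/ 2)%Z; lia. Qed.

(** Makes residues of squares available to [lia]. For x = 2q + 1 the square is 4q(q + 1) + 1, and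
    q(q + 1) is even. *)
Lemma sqr_mod8 (x : int) : exists k, x * x = 4 * k /\ (x = 0 %[mod 2])%Z
  \/ x * x = 8 * k + 1 /\ (x = 1 %[mod 2])%Z.
Proof.
have [q [->|->]] := even_or_odd x; first by exists (q * q); lia.
have [l [->|->]] := even_or_odd q; first by exists (2 * l * l + l); lia.
by exists (2 * l * l + 3 * l + 1); lia.
Qed.

(** * The quartic f and its substitutions f(s x^2) *)

Local Notation pZtoQ := (map_poly (intr : int -> rat)).

(** [B] is kept separate from [A] so that f(y) and f(-y) are the cases B = A and B = -A. *)
Definition quartic (R : comNzRingType) (B A : R) : {poly R} :=
  Poly [:: 1; B; A; B; 1].

Lemma size_quartic (R : comNzRingType) (B A : R) : size (quartic B A) = 5.
Proof. by rewrite (@PolyK _ 0) //= oner_neq0. Qed.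

Lemma quartic_monic (R : comNzRingType) (B A : R) : quartic B A \is monic.
Proof. by rewrite monicE /lead_coef size_quartic coef_Poly. Qed.

Lemma quartic_irreducible (B A : int) :
  (B = 1 %[mod 2])%Z -> (A = 1 %[mod 2])%Z -> irreducible_poly (pZtoQ (quartic B A)).
Proof.
move=> oB oA; split=> [|q q1 /dvdpP_rat_int[p [c c0 qE] [r /esym prE]]].
  by rewrite size_rat_int_poly size_quartic.
have q0 := monic_neq0 (quartic_monic B A).
have p0 : p != 0 by apply: contraNneq q0 => e; rewrite -prE e mul0r.
have r0 : r != 0 by apply: contraNneq q0 => e; rewrite -prE e mulr0.
have sz := size_mul p0 r0; rewrite prE size_quartic in sz.
suff : size p = 5.
  move=> p5; rewrite -dvdp_size_eqp qE; last first.
    by rewrite dvdpZl // -prE rmorphM dvdp_mulIl.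
  by rewrite size_scale // !size_rat_int_poly size_quartic p5.
have p1 : size p != 1%N by rewrite qE size_scale // size_rat_int_poly in q1.
apply/eqP/idPn => p5.
have coef i : (quartic B A)`_i = \sum_(j < i.+1) p`_j * r`_(i - j).
  by rewrite -prE coefM.
have k0 : 1 = p`_0 * r`_0.
  by have := coef 0; rewrite coef_Poly !big_ord_recl big_ord0 /= addr0.
have k1 : B = p`_0 * r`_1 + p`_1 * r`_0.
  by have := coef 1; rewrite coef_Poly !big_ord_recl big_ord0 /= addr0.
have k2 : A = p`_0 * r`_2 + p`_1 * r`_1 + p`_2 * r`_0.
  by have := coef 2; rewrite coef_Poly !big_ord_recl big_ord0 /= addr0 !addrA.
have k3 : B = p`_0 * r`_3 + p`_1 * r`_2 + p`_2 * r`_1 + p`_3 * r`_0.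
  by have := coef 3; rewrite coef_Poly !big_ord_recl big_ord0 /= addr0 !addrA.
have k4 : 1 = p`_0 * r`_4 + p`_1 * r`_3 + p`_2 * r`_2 + p`_3 * r`_1 + p`_4 * r`_0.
  by have := coef 4; rewrite coef_Poly !big_ord_recl big_ord0 /= addr0 !addrA.
move: p0 r0; rewrite -!size_poly_gt0 => p0 r0.
have vp i : (size p <= i)%N -> p`_i = 0 by apply: nth_default.
have vr i : (size r <= i)%N -> r`_i = 0 by apply: nth_default.
have sizes : size p = 2 /\ size r = 4 \/
    size p = 3 /\ size r = 3 \/ size p = 4 /\ size r = 2.
  by move: p1 p5 sz p0 r0; size_lia.
have d := int_unit_mul (esym k0); clear coef.
(* The extreme coefficients of both factors are 1 or -1. A linear factor would give a root modulo 2
   of y^4 + y^3 + y^2 + y + 1; for two quadratics, B odd makes one middle coefficient even, which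
   forces A even. *)
case: sizes => [[sp sr]|[[sp sr]|[sp sr]]].
- rewrite (vp 4) ?(vp 3) ?(vp 2) ?(vr 4) ?sp ?sr // in k1 k2 k3 k4.
  have : p`_1 * r`_3 = 1 by lia.
  by move=> /int_unit_mul[] [e e'] ; case: d => [] [d d'];
    rewrite ?e ?e' ?d ?d' in k1 k2 k3; lia.
- rewrite (vp 4) ?(vp 3) ?(vr 3) ?(vr 4) ?sp ?sr // in k1 k2 k3 k4.
  have : p`_2 * r`_2 = 1 by lia.
  by move=> /int_unit_mul[] [e e']; case: d => [] [d d'];
    rewrite ?e ?e' ?d ?d' in k1 k2 k3;
    (have [|k [kE|kE]] := @odd_add_even p`_1 r`_1; first lia);
    rewrite kE in k2; lia.
- rewrite (vp 4) ?(vr 2) ?(vr 3) ?(vr 4) ?sp ?sr // in k1 k2 k3 k4.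
  have : p`_3 * r`_1 = 1 by lia.
  by move=> /int_unit_mul[] [e e'] ; case: d => [] [d d'];
    rewrite ?e ?e' ?d ?d' in k1 k2 k3; lia.
Qed.

(** The equations force b and d odd. If e = -a, then 4ac = b^2 - d^2 up to sign makes c even, hence
    A even. If e = a, then b^2 = d^2, and the signs are treated separately. *)
Lemma quartic_arith (s A a b c d e : int) :
  (A = 1 %[mod 2])%Z -> s = 1 \/ s = - 1 -> a * a = 1 -> e * e = 1 ->
  s * A = 2 * e * c - d * d -> A = 2 * a * e + c * c - 2 * b * d ->
  s * A = 2 * a * c - b * b -> A = 1.
Proof.
move=> hA hs a1 e1 h1 h2 h3.
have [k hk] := sqr_mod8 b; have [l hl] := sqr_mod8 d.
have [m hm] := sqr_mod8 (c + a); have [n hn] := sqr_mod8 c.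
have {}a1 : a = 1 \/ a = - 1 by case: (int_unit_mul a1); tauto.
have [ea|ea] : e = a \/ e = - a by move: (int_unit_mul e1) a1 => []; lia.
  have [bd|bd] : b = d \/ b = - d.
  - have /eqP : b ^+ 2 = d ^+ 2 by rewrite !expr2; subst e; lia.
    by rewrite eqf_sqr => /orP[]/eqP; tauto.
  (* For s = -1 the residues modulo 8 clash. For s = 1, eliminating A leaves (c - a)^2 + 1 = b^2, so
     c = a. *)
  - subst d e; case: hs a1 => ? [] ?; subst s a; try lia.
    + have /sqr_add1 c1 : (c - 1) * (c - 1) + 1 = b * b by lia.
      have {}c1 : c = 1 by lia.
      subst c; lia.
    + have /sqr_add1 c1 : (c + 1) * (c + 1) + 1 = b * b by lia.
      have {}c1 : c = - 1 by lia.
      subst c; lia.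
  (* Eliminating A gives (c - a)^2 + 3b^2 + 1 = 0 for s = 1 and (c + a)^2 + b^2 + 1 = 0 for s =
     -1. *)
  - have := sqr_ge0 (c + a); have := sqr_ge0 (c - a); have := sqr_ge0 b; rewrite !expr2.
    by subst b e; case: hs a1 => ? [] ?; subst s a; lia.
subst e; case: hs a1 => ? [] ?; subst s a.
all: have {}hk : b * b = 8 * k + 1 by lia.
all: have {}hl : d * d = 8 * l + 1 by lia.
all: have {}hn : c * c = 4 * n by clear h2 hm; lia.
all: by clear - hA h2 hn; lia.
Qed.

(* Writing [p = a x^4 + b x^3 + c x^2 + d x + e], the coefficients of
   [graeffe p = (a y^2 + c y + e)^2 - y (b y + d)^2] must be those of the quartic. *)
Lemma graeffe_eq_quartic (s A : int) (p : {poly int}) :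
  (A = 1 %[mod 2])%Z -> s = 1 \/ s = - 1 -> size p = 5 ->
  graeffe p = quartic (s * A) A -> A = 1.
Proof.
move=> hA hs sp gE.
have coef i : (quartic (s * A) A)`_i.+1 =
    \sum_(j < i.+2) p`_j.*2 * p`_((i.+1 - j).*2)
    - \sum_(j < i.+1) p`_j.*2.+1 * p`_((i - j).*2.+1).
  rewrite -gE /graeffe coefB !expr2 coefMX !coefM /=.
  by congr (_ - _); apply: eq_bigr => j _; rewrite ?coef_even_poly ?coef_odd_poly.
have v i : (4 < i)%N -> p`_i = 0 by move=> i5; apply: nth_default; rewrite sp.
have k0 : 1 = p`_0 * p`_0.
  have : (quartic (s * A) A)`_0 = 1 by rewrite coef_Poly.
  rewrite -gE /graeffe coefB !expr2 coefMX coefM big_ord_recl big_ord0 /=.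
  by rewrite coef_even_poly addr0 subr0.
have k1 : s * A = p`_0 * p`_2 + p`_2 * p`_0 - p`_1 * p`_1.
  by have := coef 0; rewrite coef_Poly !big_ord_recl !big_ord0 /= !addr0.
have k2 : A = p`_0 * p`_4 + (p`_2 * p`_2 + p`_4 * p`_0) - (p`_1 * p`_3 + p`_3 * p`_1).
  by have := coef 1; rewrite coef_Poly !big_ord_recl !big_ord0 /= !addr0.
have k3 : s * A = p`_2 * p`_4 + p`_4 * p`_2 - p`_3 * p`_3.
  have := coef 2; rewrite coef_Poly !big_ord_recl !big_ord0 /= !addr0.
  by rewrite (v 6) // (v 5) // !(mulr0, mul0r, addr0, add0r).
have k4 : 1 = p`_4 * p`_4.
  have := coef 3; rewrite coef_Poly !big_ord_recl !big_ord0 /= !addr0.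
  by rewrite (v 8) // (v 6) // (v 7) // (v 5) // !(mulr0, mul0r, addr0, add0r, subr0).
by apply: (@quartic_arith s A p`_4 p`_3 p`_2 p`_1 p`_0) => //; lia.
Qed.

(** Passing to p(-x) multiplies the leading coefficient by (-1)^(deg p), which is 1 in even
    degree. *)
Lemma lead_coef_graeffe (R : idomainType) (p : {poly R}) :
  odd (size p) -> lead_coef (graeffe p) = lead_coef p ^+ 2.
Proof.
move=> op; have := congr1 lead_coef (graeffe_comp_X2 p).
rewrite lead_coefM !lead_coef_comp ?size_polyN ?size_polyX ?size_polyXn //.
rewrite lead_coefN lead_coefX lead_coefXn expr1n mulr1 => ->.
by rewrite -signr_odd (_ : odd (size p).-1 = false) ?mulr1 //; lia.
Qed.

Lemma quartic_comp_X2_irreducible (s A : int) :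
  (A = 1 %[mod 2])%Z -> A <> 1 -> s = 1 \/ s = - 1 ->
  irreducible_poly (pZtoQ (quartic (s * A) A) \Po 'X^2).
Proof.
move=> hA A1 hs.
have irr : irreducible_poly (pZtoQ (quartic (s * A) A)).
  by apply: quartic_irreducible => //; case: hs => ->; lia.
have sQ : size (pZtoQ (quartic (s * A) A)) = 5.
  by rewrite size_rat_int_poly size_quartic.
have QE : pZtoQ (quartic (s * A) A) \Po 'X^2 = pZtoQ (quartic (s * A) A \Po 'X^2).
  by rewrite map_comp_poly map_polyXn.
split=> [|q q1 qQ].
  by have := size_comp_X2 (pZtoQ (quartic (s * A) A)); rewrite sQ; size_lia.
move: (qQ); rewrite {1}QE => /dvdpP_rat_int[p [c c0 qE] [r /esym prE]].
rewrite qE dvdpZl // in qQ; rewrite qE size_scale // in q1.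
rewrite qE; apply: eqp_trans (eqp_scale _ c0) _.
have [//|e] := graeffe_factor irr qQ q1; case: A1.
have sp : size p = 5 by rewrite -size_rat_int_poly -size_graeffe (eqp_size e).
apply: (graeffe_eq_quartic hA hs sp).
apply: (map_inj_poly _ _ : injective pZtoQ) => //; first exact: intr_inj.
(* Associates that are both monic are equal; the leading coefficient of the integral factor [p]
   divides 1, so its square is 1. *)
rewrite -map_graeffe in e; apply/eqP; rewrite -eqp_monic //; apply: monic_map.
  rewrite monicE lead_coef_graeffe ?sp //.
  have := congr1 lead_coef prE; rewrite lead_coefM lead_coef_comp ?size_polyXn //.
  rewrite (monicP (quartic_monic _ _)) lead_coefXn expr1n mul1r.
  by move=> /int_unit_mul[] [-> _].
exact: quartic_monic.
Qed.

(** * From the quartic to [calF] *)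

Lemma quarticE (R : comNzRingType) (B A : R) :
  quartic B A = 'X^4 + B *: 'X^3 + A *: 'X^2 + B *: 'X + 1.
Proof.
apply/polyP => i; rewrite coef_Poly !(coefD, coefZ, coefXn, coefX, coef1).
case: i => [|[|[|[|[|i]]]]] /=; rewrite ?nth_nil; ring.
Qed.

Lemma map_quartic (R S : comNzRingType) (f : {rmorphism R -> S}) (B A : R) :
  map_poly f (quartic B A) = quartic (f B) (f A).
Proof.
by rewrite !quarticE !rmorphD rmorph1 /= !map_polyZ !map_polyXn map_polyX.
Qed.

Lemma quartic_compN (R : comNzRingType) (B A : R) (p : {poly R}) :
  quartic B A \Po (- p) = quartic (- B) A \Po p.
Proof.
rewrite !quarticE !(comp_polyD, comp_polyZ, comp_Xn_poly, comp_polyX) -!mul_polyC.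
rewrite -polyC1 !comp_polyC polyCN; ring.
Qed.

Lemma calFE (n : nat) (A : int) :
  (2 <= n)%N -> calF n A = quartic A A \Po 'X^(2 ^ (n - 2)).
Proof.
case: n => [|[|n]] // _; rewrite /calF !subSS !subn0.
rewrite quarticE !(comp_polyD, comp_polyZ, comp_Xn_poly, comp_polyX).
by rewrite -!exprM -polyC1 comp_polyC !expnS !(mulnC (2 ^ n)%N) mulnA.
Qed.

(* [x^8 + x^6 + x^4 + x^2 + 1 = Phi_5(x) Phi_10(x)] *)
Lemma quartic1_comp_X2 (R : comNzRingType) :
  quartic (1 : R) 1 \Po 'X^2 = quartic 1 1 * quartic (- 1) 1.
Proof.
rewrite !quarticE !(comp_polyD, comp_polyZ, comp_Xn_poly, comp_polyX).
rewrite -!mul_polyC -polyC1 !comp_polyC polyCN polyC1; ring.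
Qed.

Theorem theorem1p2 (A : int) (n : nat)
    (hA : (A = 1 %[mod 4])%Z) (hn : (3 <= n)%N) :
  irreducible_over_rat (calF n A) <-> A <> 1.
Proof.
rewrite /irreducible_over_rat calFE 1?ltnW //.
have -> : (n - 2 = (n - 3).+1)%N by lia.
split=> [irr A1|A1].
  (* For A = 1, Phi_5(x^(2^(n-3))) is a divisor of half the degree. *)
  have [_ /(_ (pZtoQ (quartic 1 1 \Po 'X^(2 ^ (n - 3)))))] := irr.
  have sz k : (size (pZtoQ (quartic 1 1 \Po 'X^(2 ^ k)))).-1 = (4 * 2 ^ k)%N.
    by rewrite size_rat_int_poly size_comp_poly size_quartic size_polyXn.
  have pos := expn_gt0 2 (n - 3).
  have q1 : size (pZtoQ (quartic 1 1 \Po 'X^(2 ^ (n - 3)))) != 1.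
    by apply/eqP => e; have := sz (n - 3)%N; rewrite e; lia.
  rewrite A1 => /(_ q1) dvd_eqp.
  have /dvd_eqp : pZtoQ (quartic 1 1 \Po 'X^(2 ^ (n - 3))) %|
      pZtoQ (quartic 1 1 \Po 'X^(2 ^ (n - 3).+1)).
    have -> : quartic 1 1 \Po 'X^(2 ^ (n - 3).+1) =
        (quartic 1 1 \Po 'X^2) \Po 'X^(2 ^ (n - 3)) :> {poly int}.
      by rewrite -comp_polyA comp_Xn_poly -exprM expnSr.
    by rewrite quartic1_comp_X2 comp_polyM rmorphM dvdp_mulIl.
  by move/eqp_size/(congr1 predn); rewrite !sz expnS; lia.
have oA : (A = 1 %[mod 2])%Z by lia.
rewrite map_comp_poly map_polyXn; apply: irreducible_comp_X2n => //.
- exact: quartic_irreducible.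
- by rewrite -{1}[A]mul1r; apply: quartic_comp_X2_irreducible => //; left.
have -> : pZtoQ (quartic A A) \Po - 'X^2 = pZtoQ (quartic (- 1 * A) A) \Po 'X^2.
  by rewrite !map_quartic rmorphM rmorphN1 mulN1r quartic_compN.
by apply: quartic_comp_X2_irreducible => //; right.
Qed.
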